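(* (i) For all $i$, $n$, all $s,t\in\omega^n$ and all $\alpha,\beta$: $s\ast\alpha\sim^i_V t\ast\beta\leftrightarrow\alpha\sim^i_V\beta$. (ii) For all $i$ and all $\alpha,\beta$: $\alpha\sim^i_V\beta\rightarrow\alpha\sim^{i+1}_V\beta$. (iii) For all $i$ and all $\gamma$: $\neg\forall\alpha[\alpha\sim^{i+1}_V\gamma\rightarrow\alpha\sim^i_V\gamma]$. (iv) For all $i,j$ and all $\alpha,\beta,\gamma$: $(\alpha\sim^i_V\beta\wedge\beta\sim^j_V\gamma)\rightarrow\alpha\sim^{i+j}_V\gamma$. (v) $\sim^\omega_V$ is an equivalence relation on $\mathcal{N}$.
   Context: Intuitionistic mathematics (constructive reading of logical constants; Markov's Principle not assumed), with Brouwer's Continuity Principle as an axiom (for every $R\subseteq\mathcal{N}\times\omega$, if $\forall\alpha\exists n[\alpha Rn]$ then $\forall\alpha\exists m\exists n\forall\beta[\overline{\alpha}m\sqsubset\beta\rightarrow\beta Rn]$, where $\overline{\alpha}m=\langle\alpha(0),\dots,\alpha(m-1)\rangle$ and $\sqsubset$ is ''initial segment of''). $\mathcal{N}=\omega^\omega$; $\omega^n$ is the set of finite sequences of length $n$; $s\ast\alpha$ is $s$ followed by $\alpha$. Relations: $\alpha\sim^0_V\beta$ iff $\exists n\forall m>n[\alpha(m)=\beta(m)]$ (the Vitali relation); $\alpha\sim^{i+1}_V\beta$ iff $\exists n\forall m>n[\alpha(m)\neq\beta(m)\rightarrow\alpha\sim^i_V\beta]$; $\alpha\sim^\omega_V\beta$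 iff $\exists i[\alpha\sim^i_V\beta]$. *)

(* Defs.v *)
From Stdlib Require Import List Arith RelationClasses.
Import ListNotations.

Definition baire := nat -> nat.

Definition agree_upto (m : nat) (a b : baire) : Prop :=
  forall k, k < m -> a k = b k.

Definition BCP : Prop :=
  forall R : baire -> nat -> Prop,
    (forall a : baire, exists n, R a n) ->
    forall a : baire, exists m n, forall b : baire, agree_upto m a b -> R b n.

Definition fin_then (s : list nat) (a : baire) : baire :=
  fun k => if k <? length s then nth k s 0 else a (k - length s).

Fixpoint vit (i : nat) (a b : baire) : Prop :=
  match i with
  | 0 => exists n, forall m, n < m -> a m = b m
  | S i' => exists n, forall m, n < m -> (a m <> b m -> vit i' a b)
  end.

Definition vit_omega (a b : baire) : Prop := exists i, vit i a b.

(* Main.v *)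
(* Whether a ~^k_V b holds depends only on the set of positions where a and b
   differ: the relation says that this set is k-thin, where a 0-thin set is
   bounded and a (k+1)-thin set is one whose elements beyond some point each
   witness that it is k-thin.  Thinness is shift invariant, inherited by
   subsets, and the union of an i-thin and a j-thin set is (i+j)-thin; this
   gives (i), (ii), (iv) and (v).  For (iii), raise g at the first i+1
   positions where an arbitrary c is nonzero: the result is ~^(i+1)_V g.  If
   it were always ~^i_V g, Brouwer's Continuity Principle would let us extend
   any finite prefix of c by one more such position each time one level of
   the relation is used up; after i+1 steps no level is left. *)
Require Import Defs.
From Stdlib Require Import List Arith RelationClasses Lia.

Fixpoint thin (k : nat) (D : nat -> Prop) : Prop :=
  exists n, forall m, n < m -> D m ->
    match k with 0 => False | S k' => thin k' D end.

Lemma thin_unfold k (D : nat -> Prop) :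
  thin k D = exists n, forall m, n < m -> D m ->
    match k with 0 => False | S k' => thin k' D end.
Proof. destruct k; reflexivity. Qed.

Lemma thin_mono k (D E : nat -> Prop) :
  (forall m, D m -> E m) -> thin k E -> thin k D.
Proof.
  intros DE; induction k as [|k IHk]; intros [n Hn]; exists n; intros m Hm Dm;
    [|apply IHk]; exact (Hn m Hm (DE m Dm)).
Qed.

Lemma thin_ext k (D E : nat -> Prop) :
  (forall m, D m <-> E m) -> (thin k D <-> thin k E).
Proof.
  intros DE; split; apply thin_mono; intro m; apply DE.
Qed.

Lemma thin_shift k n (D : nat -> Prop) :
  thin k (fun m => D (m + n)) <-> thin k D.
Proof.
  induction k as [|k IHk]; split; intros [N HN].
  - exists (N + n); intros m Hm Dm.
    apply (HN (m - n)); [lia|]. now replace (m - n + n) with m by lia.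
  - exists N; intros m Hm Dm. apply (HN (m + n)); [lia | exact Dm].
  - exists (N + n); intros m Hm Dm.
    apply IHk, (HN (m - n)); [lia|]. now replace (m - n + n) with m by lia.
  - exists N; intros m Hm Dm. apply IHk, (HN (m + n)); [lia | exact Dm].
Qed.

Lemma thin_union k : forall i j (D E : nat -> Prop),
  i + j = k -> thin i D -> thin j E -> thin k (fun m => D m \/ E m).
Proof.
  induction k as [|k IHk]; intros i j D E Hk HD HE;
    assert (HD' := HD); assert (HE' := HE); rewrite thin_unfold in HD', HE' |- *;
    destruct HD' as [n1 H1], HE' as [n2 H2];
    exists (n1 + n2); intros m Hm [Dm | Em].
  - destruct i; [exact (H1 m ltac:(lia) Dm) | lia].
  - destruct j; [exact (H2 m ltac:(lia) Em) | lia].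
  - destruct i as [|i]; [destruct (H1 m ltac:(lia) Dm)|].
    apply (IHk i j); [lia | exact (H1 m ltac:(lia) Dm) | exact HE].
  - destruct j as [|j]; [destruct (H2 m ltac:(lia) Em)|].
    apply (IHk i j); [lia | exact HD | exact (H2 m ltac:(lia) Em)].
Qed.

Lemma vit_thin k (a b : baire) : vit k a b <-> thin k (fun m => a m <> b m).
Proof.
  induction k as [|k IHk]; simpl; split; intros [n Hn]; exists n; intros m Hm.
  - intros Neq; exact (Neq (Hn m Hm)).
  - destruct (Nat.eq_dec (a m) (b m)) as [Eq | Neq]; [exact Eq | destruct (Hn m Hm Neq)].
  - intros Neq; apply IHk; exact (Hn m Hm Neq).
  - intros Neq; apply IHk; exact (Hn m Hm Neq).
Qed.

Lemma vit_refl k (a : baire) : vit k a a.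
Proof.
  rewrite vit_thin, thin_unfold; exists 0; intros m _ Neq; exfalso; exact (Neq eq_refl).
Qed.

Lemma vit_sym k (a b : baire) : vit k a b -> vit k b a.
Proof.
  rewrite !vit_thin; apply thin_mono; intros m Neq Eq; exact (Neq (eq_sym Eq)).
Qed.

Lemma vit_trans i j (a b g : baire) : vit i a b -> vit j b g -> vit (i + j) a g.
Proof.
  rewrite !vit_thin; intros Hab Hbg.
  apply (thin_mono _ _ (fun m => a m <> b m \/ b m <> g m)).
  - intros m Neq; destruct (Nat.eq_dec (a m) (b m)) as [Eq | Neq'];
      [right; congruence | left; exact Neq'].
  - exact (thin_union _ i j _ _ eq_refl Hab Hbg).
Qed.

Lemma vit_succ i (a b : baire) : vit i a b -> vit (S i) a b.
Proof.
  intros H; exists 0; intros; exact H.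
Qed.

Lemma fin_then_tail s (a : baire) m : fin_then s a (m + length s) = a m.
Proof.
  unfold fin_then; destruct (Nat.ltb_spec (m + length s) (length s)); [lia|].
  f_equal; lia.
Qed.

Lemma vit_fin_then k (s t : list nat) (a b : baire) :
  length s = length t -> (vit k (fin_then s a) (fin_then t b) <-> vit k a b).
Proof.
  intros Hst; rewrite !vit_thin, <- (thin_shift k (length s)).
  apply thin_ext; intro m; rewrite fin_then_tail, Hst, fin_then_tail; reflexivity.
Qed.

Lemma vit_omega_equiv : Equivalence vit_omega.
Proof.
  split.
  - intro a; exists 0; apply vit_refl.
  - intros a b [i H]; exists i; now apply vit_sym.
  - intros a b g [i Hab] [j Hbg]; exists (i + j); exact (vit_trans i j a b g Hab Hbg).
Qed.

Lemma agree_upto_refl m (a : baire) : agree_upto m a a.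
Proof. intros k _; reflexivity. Qed.

Lemma agree_upto_le m m' (a b : baire) :
  m <= m' -> agree_upto m' a b -> agree_upto m a b.
Proof. intros Hm A k Hk; apply A; lia. Qed.

Lemma agree_upto_dec m (a b : baire) : agree_upto m a b \/ ~ agree_upto m a b.
Proof.
  induction m as [|m [A | NA]].
  - left; intros k Hk; lia.
  - destruct (Nat.eq_dec (a m) (b m)) as [Eq | Neq].
    + left; intros k Hk; destruct (Nat.eq_dec k m) as [-> | Hkm]; [exact Eq | apply A; lia].
    + right; intros A'; exact (Neq (A' m ltac:(lia))).
  - right; intros A'; exact (NA (agree_upto_le m (S m) a b ltac:(lia) A')).
Qed.

Fixpoint count_nonzero (c : baire) (m : nat) : nat :=
  match m with
  | 0 => 0
  | S m' => count_nonzero c m' + (if c m' =? 0 then 0 else 1)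
  end.

Lemma count_nonzero_mono c m m' : m <= m' -> count_nonzero c m <= count_nonzero c m'.
Proof. induction 1; simpl; lia. Qed.

Lemma count_nonzero_S_neq0 c m :
  c m <> 0 -> count_nonzero c (S m) = S (count_nonzero c m).
Proof. intros Hc; simpl; destruct (Nat.eqb_spec (c m) 0); [contradiction | lia]. Qed.

Lemma count_nonzero_agree m c d :
  agree_upto m c d -> count_nonzero c m = count_nonzero d m.
Proof.
  induction m as [|m IHm]; intros A; simpl; [reflexivity|].
  rewrite (A m), IHm by (try apply (agree_upto_le m (S m)); auto); reflexivity.
Qed.

Lemma count_nonzero_pad L P c :
  L <= P -> count_nonzero (fun q => if q <? L then c q else 0) P = count_nonzero c L.
Proof.
  induction P as [|P IHP]; intros HLP.
  - now replace L with 0 by lia.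
  - destruct (Nat.eq_dec L (S P)) as [-> | HL].
    + apply count_nonzero_agree; intros q Hq; now rewrite (proj2 (Nat.ltb_lt q (S P)) Hq).
    + simpl; rewrite IHP by lia.
      now rewrite (proj2 (Nat.ltb_ge P L) ltac:(lia)).
Qed.

Definition first_support (K : nat) (c : baire) (m : nat) : Prop :=
  c m <> 0 /\ count_nonzero c m < K.

Lemma thin_first_support K k n c :
  K <= k + count_nonzero c n -> thin k (first_support K c).
Proof.
  revert n; induction k as [|k IHk]; intros n Hk; exists n; intros m Hm [Hc HK];
    pose proof (count_nonzero_mono c n m ltac:(lia)).
  - lia.
  - apply (IHk (S m)); rewrite count_nonzero_S_neq0 by exact Hc; lia.
Qed.

Section Continuity.

Hypothesis bcp : BCP.
Variable K : nat.

Lemma first_support_force (Q : baire -> Prop) L c0 :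
  count_nonzero c0 L < K ->
  (forall c, agree_upto L c0 c ->
     exists n, forall m, n < m -> first_support K c m -> Q c) ->
  exists L' c0', count_nonzero c0' L' = S (count_nonzero c0 L) /\
    forall c, agree_upto L' c0' c -> Q c.
Proof.
  intros HK H.
  set (R := fun c n => agree_upto L c0 c ->
              forall m, n < m -> first_support K c m -> Q c).
  assert (Rtot : forall c, exists n, R c n).
  { intros c; destruct (agree_upto_dec L c0 c) as [A | NA].
    - destruct (H c A) as [n Hn]; exists n; intros _; exact Hn.
    - exists 0; intros A; contradiction. }
  (* Continuity at c0 followed by zeros: one new nonzero entry beyond both the
     modulus M and the bound N lies in first_support K c and so forces Q c. *)
  set (base := fun q => if q <? L then c0 q else 0).
  destruct (bcp R Rtot base) as (M & N & HMN).
  set (P := S (L + M + N)).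
  set (c0' := fun q => if q =? P then 1 else base q).
  assert (Hc0'P : c0' P <> 0) by (unfold c0'; rewrite Nat.eqb_refl; discriminate).
  assert (Hc0' : agree_upto P base c0')
    by (intros q Hq; unfold c0'; now rewrite (proj2 (Nat.eqb_neq q P) ltac:(lia))).
  assert (Hcount : forall c, agree_upto P base c -> count_nonzero c P = count_nonzero c0 L)
    by (intros c A; rewrite <- (count_nonzero_agree P _ _ A); apply count_nonzero_pad; lia).
  exists (S P), c0'; split.
  - rewrite count_nonzero_S_neq0 by exact Hc0'P; now rewrite Hcount.
  - intros c A.
    assert (AP : agree_upto P base c)
      by (intros q Hq; rewrite (Hc0' q Hq); apply A; lia).
    apply (HMN c (agree_upto_le M P _ _ ltac:(lia) AP)) with (m := P); [| lia | split].
    + intros q Hq; rewrite <- (AP q ltac:(lia)); unfold base.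
      now rewrite (proj2 (Nat.ltb_lt q L) Hq).
    + rewrite <- (A P ltac:(lia)); exact Hc0'P.
    + rewrite Hcount by exact AP; exact HK.
Qed.

Lemma not_thin_first_support k : forall L c0,
  k + count_nonzero c0 L < K ->
  ~ (forall c, agree_upto L c0 c -> thin k (first_support K c)).
Proof.
  induction k as [|k IHk]; intros L c0 Hk H.
  - destruct (first_support_force (fun _ => False) L c0 ltac:(lia) H) as (L' & c0' & _ & HF).
    exact (HF c0' (agree_upto_refl L' c0')).
  - destruct (first_support_force (fun c => thin k (first_support K c)) L c0 ltac:(lia) H)
      as (L' & c0' & Hcount & HQ).
    exact (IHk L' c0' ltac:(lia) HQ).
Qed.

End Continuity.

Definition perturb (K : nat) (g c : baire) : baire :=
  fun m => if c m =? 0 then g m else if count_nonzero c m <? K then S (g m) else g m.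

Lemma vit_perturb k K (g c : baire) :
  vit k (perturb K g c) g <-> thin k (first_support K c).
Proof.
  rewrite vit_thin; apply thin_ext; intro m; unfold perturb, first_support.
  destruct (Nat.eqb_spec (c m) 0), (Nat.ltb_spec (count_nonzero c m) K); simpl;
    split; try lia; intros [Hc HK]; lia.
Qed.

Lemma vit_succ_not_vit : BCP -> forall i (g : baire),
  ~ (forall a : baire, vit (S i) a g -> vit i a g).
Proof.
  intros bcp i g H.
  apply (not_thin_first_support bcp (S i) i 0 (fun _ => 0)); [simpl; lia|].
  intros c _; apply (vit_perturb _ _ g), H, vit_perturb.
  apply (thin_first_support _ _ 0); lia.
Qed.

Theorem theorem10p2 :
  BCP ->
  (forall (i n : nat) (s t : list nat) (a b : baire),
      length s = n -> length t = n ->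
      (vit i (fin_then s a) (fin_then t b) <-> vit i a b))
  /\ (forall (i : nat) (a b : baire), vit i a b -> vit (S i) a b)
  /\ (forall (i : nat) (g : baire),
      ~ (forall a : baire, vit (S i) a g -> vit i a g))
  /\ (forall (i j : nat) (a b g : baire),
      vit i a b /\ vit j b g -> vit (i + j) a g)
  /\ Equivalence vit_omega.
Proof.
  intros bcp; split; [|split; [|split; [|split]]].
  - intros i n s t a b Hs Ht; apply vit_fin_then; congruence.
  - exact vit_succ.
  - exact (vit_succ_not_vit bcp).
  - intros i j a b g [Hab Hbg]; exact (vit_trans i j a b g Hab Hbg).
  - exact vit_omega_equiv.
Qed.
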